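(* For every $b$ and $C$ (real numbers) there is $F$ with the following property. Let $K$ be a $\mathbb{Z}[t,t^{-1}]$-module and let $(I_1,I_2)$ and $(I_1',I_2')$ be two pairs of valuations for $K$, both with the given constant $C$ and with the same given $b_1=b$. Let $A\subseteq K$ be a finite good generating set for $K$ (with respect to these two pairs) with fuzziness $(F,F')$ for some $F'$. Then $K\rtimes\langle t\rangle$ has deep pockets with respect to $\{ata' : a,a'\in A\}\cup A$.
   Context: Pair of valuations: for a $\mathbb{Z}[t,t^{-1}]$-module $K$, functions $I_1,I_2:K\setminus\{0\}\to\mathbb{R}$ form a pair of valuations with constants $C,b\in\mathbb{R}$ (where $b=b_1$) if, for all $k_1,k_2\in K\setminus\{0\}$: $I_1(tk_1)=I_1(k_1)+b$; $I_2(tk_1)=I_2(k_1)-b$; $I_1(-k_1)=I_1(k_1)$ and $I_2(-k_1)=I_2(k_1)$; and, whenever $k_1+k_2\neq0$, $I_1(k_1+k_2)\le\max(I_1(k_1),I_1(k_2))+C$ and $I_2(k_1+k_2)\le\max(I_2(k_1),I_2(k_2))+C$. Good generating set: let $(I_1,I_2)$ and $(I_1',I_2')$ be two pairs of valuations for $K$ with the same $b$. A subset $A\subseteq K$ is a good generating set for $K$ with fuzziness $(F,F')$ if: $0\in A$; $A=-A$; for all $a\in A\setminus\{0\}$, $I_1'(a)\le I_1(a)$ and $I_2'(a)\le I_2(a)$; and for all $k\in K\setminus\{0\}$ with $I_1'(k)\le I_1(k)+F$ and $I_2'(k)\le I_2(k)+F$, there are elements $a_i\in A$ for all $i\in\mathbb{Z}$,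 and integers $i_j\in\mathbb{Z}$ and elements $c_j\in A$ for $1\le j\le F'$, such that (1) $a_i=0$ except for those $i$ with $\min(-I_2(k),0)-F'\le bi\le\max(I_1(k),0)+F'$; (2) $k-\sum_i t^ia_i=\sum_{j=1}^{F'}t^{i_j}c_j$; (3) $\min(-I_2(k),0)-F'\le b\,i_j\le\max(I_1(k),0)+F'$ for all $j$. In the semidirect product $K\rtimes\langle t\rangle$ ($t$ of infinite order), elements are pairs $(m,k)$ with $m\in\mathbb{Z}$, $k\in K$ and multiplication $(m_1,k_1)(m_2,k_2)=(m_1+m_2,t^{m_2}k_1+k_2)$; $K$ is identified with $\{(0,k)\}$, $t$ with $(1,0)$, and $ata'$ denotes a product in this group. Deep pockets: for a group $G$ with generating set $S$, word length $\|\cdot\|_S$ and word metric $d$, the depth of $g\in G$ is the distance from $g$ to the complement of the closed ball of radius $\|g\|_S$ about the identity. $G$ has deep pockets with respect to $S$ if it has elements of arbitrarily large depth.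
   Formalization: It is assumed that b ≠ 0 and that A contains a nonzero element; the claim fails for b = 0 (K = Z with trivial t-action gives Z²) and for K = 0 (the group is Z), and if A = {0} with K ≠ 0 the given set does not generate. *)

(* Defs.v *)
From HB Require Import structures.
From mathcomp Require Import all_boot all_order all_algebra.
From mathcomp Require Import boolp classical_sets cardinality fsbigop reals.

Set Implicit Arguments.
Unset Strict Implicit.
Unset Printing Implicit Defensive.

Import Order.TTheory GRing.Theory Num.Theory.

Local Open Scope classical_set_scope.
Local Open Scope ring_scope.

(* Z[t,t^-1] is realised inside Q(t), as the subring of the fractions
   p / t^n with p in Z[t]. *)
Definition laurent_pred : {pred {fraction {poly int}}} :=
  fun x => `[< exists (p : {poly int}) (n : nat),
                 x = @tofrac {poly int} p / (@tofrac {poly int} 'X) ^+ n >].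

Lemma tofracX_neq0 : @tofrac {poly int} 'X != 0.
Proof. by rewrite tofrac_eq0 polyX_eq0. Qed.

Lemma laurent_subring_closed : subring_closed laurent_pred.
Proof.
split=> [|x y|x y].
- by apply/asboolP; exists 1, 0%N; rewrite expr0 divr1 tofrac1.
- move=> /asboolP[p [n ->]] /asboolP[q [m ->]]; apply/asboolP.
  exists (p * 'X ^+ m - q * 'X ^+ n), (n + m)%N.
  rewrite tofracB !tofracM !tofracXn exprD mulrBl.
  have X0 k : (@tofrac {poly int} 'X) ^+ k != 0.
    by rewrite expf_neq0// tofracX_neq0.
  congr (_ - _).
    by rewrite -mulf_div (divff (X0 m)) mulr1.
  by rewrite (mulrC (_ ^+ n) (_ ^+ m)) -mulf_div (divff (X0 n)) mulr1.
- move=> /asboolP[p [n ->]] /asboolP[q [m ->]]; apply/asboolP.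
  by exists (p * q), (n + m)%N; rewrite mulf_div tofracM exprD.
Qed.

HB.instance Definition _ :=
  GRing.isSubringClosed.Build {fraction {poly int}} laurent_pred
    laurent_subring_closed.

Record laurent : Type := Laurent {
  laurent_val :> {fraction {poly int}};
  laurent_valP : laurent_val \in laurent_pred }.

HB.instance Definition _ := [isSub for laurent_val].
HB.instance Definition _ := [Choice of laurent by <:].
HB.instance Definition _ := [SubChoice_isSubComNzRing of laurent by <:].

Lemma laurent_predXz (i : int) : (@tofrac {poly int} 'X) ^ i \in laurent_pred.
Proof.
apply/asboolP; case: i => n.
  by exists ('X ^+ n), 0%N; rewrite expr0 divr1 tofracXn.
by exists 1, n.+1; rewrite tofrac1 div1r NegzE -exprnN.
Qed.

(* The unit t^i of Z[t,t^-1], for i in Z. *)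
Definition tpow (i : int) : laurent := Laurent (laurent_predXz i).

Lemma tpow0 : tpow 0 = 1.
Proof. exact/val_inj. Qed.

Lemma tpowD (i j : int) : tpow (i + j) = tpow i * tpow j.
Proof. by apply/val_inj; rewrite /= expfzDr// tofracX_neq0. Qed.

Section Semidirect.
Variable K : lmodType laurent.

Definition semidirect : Type := (int * K)%type.

HB.instance Definition _ := Choice.on semidirect.

Definition sd_mul (x y : semidirect) : semidirect :=
  (x.1 + y.1, tpow y.1 *: x.2 + y.2).
Definition sd_one : semidirect := (0, 0).
Definition sd_inv (x : semidirect) : semidirect :=
  (- x.1, - (tpow (- x.1) *: x.2)).

Lemma sd_mulA : associative sd_mul.
Proof.
move=> x y z; rewrite /sd_mul/= addrA; congr pair.
by rewrite scalerDr scalerA -tpowD addrA [z.1 + _]addrC.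
Qed.

Lemma sd_mul1g : left_id sd_one sd_mul.
Proof. by case=> m k; rewrite /sd_mul/= add0r scaler0 add0r. Qed.

Lemma sd_mulg1 : right_id sd_one sd_mul.
Proof. by case=> m k; rewrite /sd_mul/= !addr0 tpow0 scale1r. Qed.

Lemma sd_mulVg : left_inverse sd_one sd_inv sd_mul.
Proof.
case=> m k; rewrite /sd_mul/= addNr scalerN scalerA -tpowD subrr tpow0.
by rewrite scale1r addNr.
Qed.

Lemma sd_mulgV : right_inverse sd_one sd_inv sd_mul.
Proof. by case=> m k; rewrite /sd_mul/= !subrr. Qed.

HB.instance Definition _ :=
  isGroup.Build semidirect sd_mulA sd_mul1g sd_mulg1 sd_mulVg sd_mulgV.

Definition sd_in (k : K) : semidirect := (0, k).
Definition sd_t : semidirect := (1, 0).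

Definition semidirect_gens (A : set K) : set semidirect :=
  [set (sd_in a * sd_t * sd_in a')%g | a in A & a' in A]
  `|` [set sd_in a | a in A].

End Semidirect.

Section Valuations.
Variables (R : realType) (K : lmodType laurent).

(* Functions on K \ {0} are represented by functions on K whose value at 0 is
   never used. *)
Record pair_of_valuations (C b : R) (I1 I2 : K -> R) : Prop := {
  pov_t1 : forall k, k != 0 -> I1 (tpow 1 *: k) = I1 k + b;
  pov_t2 : forall k, k != 0 -> I2 (tpow 1 *: k) = I2 k - b;
  pov_opp1 : forall k, k != 0 -> I1 (- k) = I1 k;
  pov_opp2 : forall k, k != 0 -> I2 (- k) = I2 k;
  pov_add1 : forall k1 k2, k1 != 0 -> k2 != 0 -> k1 + k2 != 0 ->
    I1 (k1 + k2) <= Num.max (I1 k1) (I1 k2) + C;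
  pov_add2 : forall k1 k2, k1 != 0 -> k2 != 0 -> k1 + k2 != 0 ->
    I2 (k1 + k2) <= Num.max (I2 k1) (I2 k2) + C }.

Definition in_window (b : R) (I1 I2 : K -> R) (F' : nat) (k : K) (i : int) :=
  Num.min (- I2 k) 0 - F'%:R <= b * i%:~R <= Num.max (I1 k) 0 + F'%:R.

(* The sum over i : int is a finitely supported sum: for b != 0 only finitely
   many i lie in the window. *)
Record good_generating_set (b : R) (I1 I2 I1' I2' : K -> R)
    (F : R) (F' : nat) (A : set K) : Prop := {
  ggs_0 : A 0;
  ggs_opp : [set - a | a in A] = A;
  ggs_le : forall a, A a -> a != 0 -> I1' a <= I1 a /\ I2' a <= I2 a;
  ggs_decomp : forall k, k != 0 -> I1' k <= I1 k + F -> I2' k <= I2 k + F ->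
    exists (a : int -> K) (ij : 'I_F' -> int) (c : 'I_F' -> K),
      [/\ (forall i, A (a i)) /\ (forall j, A (c j)),
          forall i, ~~ in_window b I1 I2 F' k i -> a i = 0,
          k - \sum_(i \in [set: int]) (tpow i *: a i) =
            \sum_(j < F') (tpow (ij j) *: c j)
        & forall j, in_window b I1 I2 F' k (ij j)] }.

End Valuations.

Section Depth.
Variables (G : groupType) (S : set G).

Definition is_word (w : seq G) : Prop :=
  forall x, x \in w -> S x \/ S (x^-1)%g.

Definition generates : Prop :=
  forall g : G, exists2 w, is_word w & g = (\prod_(x <- w) x)%g.

(* Least element of a set of natural numbers; the junk value 0 is returned for
   the empty set. *)
Definition nat_least (P : set nat) : nat :=
  if pselect (exists n, `[< P n >]) is left e then ex_minn e else 0%N.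

Definition word_length (g : G) : nat :=
  nat_least [set size w | w in [set w | is_word w /\ g = (\prod_(x <- w) x)%g]].

Definition word_dist (g h : G) : nat := word_length (g^-1 * h)%g.

Definition word_ball (n : nat) : set G := [set h | (word_length h <= n)%N].

Definition depth (g : G) : nat :=
  nat_least [set word_dist g h | h in ~` word_ball (word_length g)].

(* Word length and depth are relative to a generating set, so that S generates
   G is part of the assertion; it also makes every word length a genuine
   minimum. *)
Definition has_deep_pockets : Prop :=
  generates /\ forall n : nat, exists g : G, (n <= depth g)%N.

End Depth.

(* Main.v *)
(* Replacing (b, I1, I2) by (-b, I2, I1) we may assume b > 0. For a nonzero a in
   A and large p, put k = t^p a + t^-p a and g = (0, k). A product gh with h
   short has the form (m, t^m k + x) with x small; its values under I1 and I2 are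
   b(p + m) and b(p - m) up to a constant, so that [ggs_decomp] writes it as a
   walk from 0 to m covering [m - p, p + m] up to a constant, of length at most
   4p + O(1). Conversely, a word of length at most 8p for g whose walk covers
   only [-L, U] has I1(k) <= bU + O(log p) and I2(k) <= bL + O(log p), by adding
   up its letters along a balanced tree; hence g has length at least
   4p - O(log p). So the length of gh exceeds that of g by O(log p) at most, for
   all h of length at most O(log p), and climbing by steps of bounded length from
   g has to stop at an element of large depth. *)
Require Import Defs.
From mathcomp Require Import all_boot all_order all_algebra.
From mathcomp Require Import boolp classical_sets cardinality fsbigop reals.
From mathcomp Require Import zify ring lra.

Import Order.TTheory GRing.Theory Num.Theory.
Local Open Scope classical_set_scope.
Local Open Scope ring_scope.

Set Implicit Arguments.
Unset Strict Implicit.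

(** * Word length, depth and a criterion for deep pockets *)

Lemma nat_least_le (P : set nat) n : P n -> (nat_least P <= n)%N.
Proof.
move=> Pn; rewrite /nat_least; case: pselect => [e|[]].
  by case: ex_minnP => m _; apply; apply/asboolP.
by exists n; apply/asboolP.
Qed.

Lemma nat_least_in (P : set nat) n : P n -> P (nat_least P).
Proof.
move=> Pn; rewrite /nat_least; case: pselect => [e|[]].
  by case: ex_minnP => m /asboolP.
by exists n; apply/asboolP.
Qed.

Section WordMetric.
Variables (G : groupType) (S : set G).

Lemma is_word_cat u v : is_word S u -> is_word S v -> is_word S (u ++ v).
Proof. by move=> Su Sv x; rewrite mem_cat => /orP[/Su|/Sv]. Qed.

Lemma is_word_cons x w : S x \/ S (x^-1)%g -> is_word S w -> is_word S (x :: w).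
Proof. by move=> Sx Sw y; rewrite inE => /predU1P[->|/Sw]. Qed.

Lemma word_length_le w :
  is_word S w -> (word_length S (\prod_(x <- w) x)%g <= size w)%N.
Proof. by move=> Sw; apply: nat_least_le; exists w. Qed.

Hypothesis genS : generates S.

Lemma word_length_attained g :
  exists w, [/\ is_word S w, g = (\prod_(x <- w) x)%g & size w = word_length S g].
Proof.
have [w Sw gw] := genS g.
have [|v [Sv gv] vg] := @nat_least_in
    [set size w | w in [set w | is_word S w /\ g = (\prod_(x <- w) x)%g]] (size w).
  by exists w.
by exists v.
Qed.

Lemma word_lengthM g h :
  (word_length S (g * h)%g <= word_length S g + word_length S h)%N.
Proof.
have [u [Su gu <-]] := word_length_attained g.
have [v [Sv hv <-]] := word_length_attained h.
rewrite -size_cat gu hv -big_cat; apply: word_length_le; exact: is_word_cat.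
Qed.

(* If depths were less than N, one could climb D + 1 times from g, gaining at
   least 1 in length at each step of length less than N. *)
Lemma deep_pockets_criterion :
  (forall n, exists g, (n < word_length S g)%N) ->
  (forall N, exists g D, forall h, (word_length S h <= N * D.+1)%N ->
     (word_length S (g * h)%g <= word_length S g + D)%N) ->
  has_deep_pockets S.
Proof.
move=> unb climb; split=> // N; apply: contrapT => /forallNP shallow.
have [g [D gD]] := climb N.
have up g1 : exists h, (word_length S h <= N)%N /\
    (word_length S g1 < word_length S (g1 * h)%g)%N.
  have [g2 g12] := unb (word_length S g1).
  (* The longer element [g2] shows that the complement of the ball is nonempty, so the depth is an
     attained distance and not the default 0. *)
  have [|g3 /= g13 dg3] := @nat_least_in [set word_dist S g1 h |
      h in ~` word_ball S (word_length S g1)] (word_dist S g1 g2).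
    by exists g2 => //=; apply/negP; rewrite -ltnNge.
  exists (g1^-1 * g3)%g; rewrite mulgA mulgV mul1g; split.
    have := shallow g1; rewrite /depth -dg3 /word_dist; lia.
  by move/negP: g13; rewrite -ltnNge.
have chain j : exists h, (word_length S h <= N * j)%N /\
    (word_length S g + j <= word_length S (g * h)%g)%N.
  elim: j => [|j [h [hN gh]]].
    exists 1%g; rewrite mulg1 addn0; split=> //.
    by have := @word_length_le [::]; rewrite big_nil muln0; apply.
  have [h' [h'N gh']] := up (g * h)%g; exists (h * h')%g; rewrite mulgA; split.
    by apply: leq_trans (word_lengthM _ _) _; rewrite mulnS; lia.
  by rewrite addnS; apply: leq_ltn_trans gh gh'.
have [h [/gD]] := chain D.+1; lia.
Qed.

End WordMetric.

(** * Valuations up to an additive constant *)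

Section QuasiValuations.
Variables (R : realType) (K : lmodType laurent).
Implicit Types (I : K -> R) (k x y : K) (C c B : R).

Lemma tpow_scale_eq0 i k : (tpow i *: k == 0) = (k == 0).
Proof.
apply/eqP/eqP => [ik0|->]; last by rewrite scaler0.
by rewrite -[k]scale1r -tpow0 -[0](addNr i) tpowD -scalerA ik0 scaler0.
Qed.

(** One half of a pair of valuations: [c] is [b] for the first function and [-b] for the second, so
    that each estimate is proved only once. *)
Record quasi_valuation C c I : Prop := {
  qv_t : forall k, k != 0 -> I (tpow 1 *: k) = I k + c;
  qv_opp : forall k, k != 0 -> I (- k) = I k;
  qv_add : forall k1 k2, k1 != 0 -> k2 != 0 -> k1 + k2 != 0 ->
    I (k1 + k2) <= Num.max (I k1) (I k2) + C }.

(** Since 0 satisfies every bound, sums can be estimated without asking which partial sums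
    cancel. *)
Definition val_le I B k := k != 0 -> I k <= B.

Lemma val_leW I B B' k : B <= B' -> val_le I B k -> val_le I B' k.
Proof. by move=> BB' kB /kB /le_trans; apply. Qed.

Lemma val_le0 I B : val_le I B 0.
Proof. by rewrite /val_le eqxx. Qed.

Lemma qv_tpow C c I : quasi_valuation C c I ->
  forall i k, k != 0 -> I (tpow i *: k) = I k + c * i%:~R.
Proof.
move=> qI i k k0; have k0' j : tpow j *: k != 0 by rewrite tpow_scale_eq0.
elim/int_rect: i => [|n IH|n IH]; first by rewrite tpow0 scale1r mulr0 addr0.
  rewrite -addn1 PoszD addrC tpowD -scalerA (qv_t qI)// IH intrD; lra.
have := qv_t qI (k0' (- n.+1%:Z)).
rewrite scalerA -tpowD.
have -> : 1 + - n.+1%:Z = - n%:Z by lia.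
rewrite IH -addn1 PoszD opprD intrD; lra.
Qed.

Lemma val_leN C c I B k : quasi_valuation C c I -> val_le I B k -> val_le I B (- k).
Proof. by move=> qI kB; rewrite /val_le oppr_eq0 => k0; rewrite (qv_opp qI)// kB. Qed.

Lemma val_le_tpow C c I B i k : quasi_valuation C c I ->
  val_le I B k -> val_le I (B + c * i%:~R) (tpow i *: k).
Proof.
move=> qI kB; rewrite /val_le tpow_scale_eq0 => k0.
by rewrite (qv_tpow qI)// lerD2r kB.
Qed.

Lemma val_leD C c I B x y : 0 <= C -> quasi_valuation C c I ->
  val_le I B x -> val_le I B y -> val_le I (B + C) (x + y).
Proof.
move=> C0 qI; have [->|x0] := eqVneq x 0.
  by rewrite add0r => _; apply: val_leW; rewrite lerDl.
have [->|y0] := eqVneq y 0.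
  by rewrite addr0 => + _; apply: val_leW; rewrite lerDl.
move=> xB yB xy0; apply: le_trans (qv_add qI x0 y0 xy0) _.
by rewrite lerD2r ge_max xB// yB.
Qed.

(** Halving the list adds [C] only once per level of the tree, so the error is logarithmic in the
    number of terms instead of linear. *)
Lemma val_le_sum C c I B d s : 0 <= C -> quasi_valuation C c I ->
  (size s <= 2 ^ d)%N -> (forall x, x \in s -> val_le I B x) ->
  val_le I (B + C * d%:R) (\sum_(x <- s) x).
Proof.
move=> C0 qI; elim: d s => [|d IH] s sd sB.
  case: s sd sB => [|x [|//]] _ sB.
    by rewrite big_nil; exact: val_le0.
  by rewrite big_seq1 mulr0 addr0; apply: sB; rewrite inE.
rewrite -(cat_take_drop (2 ^ d) s) big_cat/=.
rewrite -addn1 natrD mulrDr mulr1 addrA.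
apply: (val_leD C0 qI); apply: IH.
- by rewrite size_take_min geq_minl.
- by move=> x /mem_take /sB.
- by rewrite size_drop; move: sd; rewrite expnS; lia.
- by move=> x /mem_drop /sB.
Qed.

Definition peaks (a : K) (p : int) : K := tpow p *: a + tpow (- p) *: a.

Lemma peaksN a p : peaks a (- p) = peaks a p.
Proof. by rewrite /peaks opprK addrC. Qed.

(* The two summands of [peaks a p] have very different values, so that neither
   can be cancelled by the other or by the small term x. *)
Lemma peaks_bounds C c B M P Q v I a x (p m : int) :
  0 <= C -> quasi_valuation C c I ->
  c * p%:~R = P -> c * m%:~R = Q -> I a = v ->
  a != 0 -> - M <= v -> C < P -> B + 2 * C + M < P + Q -> val_le I B x ->
  let y := tpow m *: peaks a p + x in
  y != 0 /\ P + Q + v - 2 * C <= I y <= P + Q + v + 2 * C.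
Proof.
move=> C0 qI cp cm Ia a0 vM p_large x_small xB y.
have aa : val_le I v a by rewrite -Ia.
have upper : val_le I (P + Q + v + 2 * C) y.
  have -> : P + Q + v + 2 * C = (v + P + C + Q) + C by ring.
  apply: (val_leD C0 qI); last by apply: val_leW xB; lra.
  rewrite -cm; apply: (val_le_tpow qI); apply: (val_leD C0 qI).
    by rewrite -cp; exact: val_le_tpow qI aa.
  by apply: val_leW (val_le_tpow qI aa); rewrite mulrNz mulrN cp; lra.
(* The dominant peak is [y] minus [x] and the other peak, so its value is at most the largest of the
   three bounds plus [2 * C]. The bounds on [x] and on the other peak are too small for this, so
   [B'] has to be large. *)
have lower B' : val_le I B' y -> P + Q + v - 2 * C <= B'.
  move=> yB'; rewrite leNgt; apply/negP => B'lt.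
  have vE : I (tpow (m + p) *: a) = v + Q + P.
    by rewrite (qv_tpow qI)// intrD mulrDr cp cm addrA Ia.
  have yE : tpow (m + p) *: a = (y - x) - tpow (m - p) *: a.
    by rewrite /y addrK /peaks scalerDr !scalerA -!tpowD addrK.
  pose W := Num.max B' (Num.max B (v + Q - P)).
  have W1 : val_le I W y by apply: val_leW yB'; rewrite le_max lexx.
  have W2 : val_le I W (- x).
    by apply: (val_leN qI); apply: val_leW xB; rewrite !le_max lexx orbT.
  have W3 : val_le I (W + C) (- (tpow (m - p) *: a)).
    apply: (val_leN qI); apply: val_leW (val_le_tpow qI aa).
    apply: (@le_trans _ _ W); last by rewrite lerDl.
    by rewrite /W intrD mulrNz mulrDr mulrN cp cm addrA !le_max lexx !orbT.
  have := val_leD C0 qI (val_leD C0 qI W1 W2) W3.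
  rewrite -yE /val_le tpow_scale_eq0 vE => /(_ a0).
  suff : W < v + Q + P - 2 * C by lra.
  by rewrite /W !gt_max; apply/and3P; split; lra.
(* If [y] were 0, every [B'] would be allowed in [lower]. *)
have y0 : y != 0.
  apply/negP => /eqP y0; have := lower (P + Q + v - 2 * C - 1).
  rewrite y0 => /(_ (@val_le0 _ _)); lra.
by split=> //; rewrite lower ?upper// => _.
Qed.

End QuasiValuations.

(** * Words in the semidirect product as walks on the integers *)

Section Words.
Variable K : lmodType laurent.
Implicit Types (A : set K) (g x y : semidirect K) (w : seq (semidirect K)).

Lemma semidirect_mulE x y : (x * y)%g = (x.1 + y.1, tpow y.1 *: x.2 + y.2).
Proof. by []. Qed.

Lemma semidirect_prod_cons x w : (\prod_(y <- x :: w) y)%g =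
  (x.1 + (\prod_(y <- w) y)%g.1,
   tpow (\prod_(y <- w) y)%g.1 *: x.2 + (\prod_(y <- w) y)%g.2).
Proof. by rewrite big_cons. Qed.

(** Inside the range, one more step makes up for a decrease of [|m|] by at most 1. A step that
    leaves the range moves away from 0, so [n + |m|] gains the 2 that the longer range costs. *)
Lemma walk_step (U L n : nat) (m e : int) :
  `|e| <= 1 -> - L%:Z <= m <= U%:Z -> (2 * (U + L) <= n + `|m|)%N ->
  exists U' L' : nat, [/\ (U <= U')%N, (L <= L')%N, - L'%:Z <= e + m <= U'%:Z
    & (2 * (U' + L') <= n.+1 + `|(e + m)%R|)%N].
Proof.
move=> e1 mUL UL.
have [emU|emU] := leP (e + m) U%:Z; last by exists U.+1, L; split; lia.
have [emL|emL] := leP (- L%:Z) (e + m); last by exists U, L.+1; split; lia.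
by exists U, L; split; lia.
Qed.

(* Reading a word from the right, the first coordinate performs a walk, which
   has to be of length at least 2(U + L) - |m| to cover [-L, U] and end in m. *)
Lemma word_walk w : (forall x, x \in w -> `|x.1|%R <= 1) ->
  exists (U L : nat) (s : seq (int * K)),
    [/\ size s = size w,
        (\prod_(y <- w) y)%g.2 = \sum_(q <- s) tpow q.1 *: q.2,
        - L%:Z <= (\prod_(y <- w) y)%g.1 <= U%:Z,
        (2 * (U + L) <= size w + `|(\prod_(y <- w) y)%g.1|)%N
      & forall q, q \in s ->
          - L%:Z <= q.1 <= U%:Z /\ exists2 x, x \in w & q.2 = x.2].
Proof.
elim: w => [|x w IH] w1.
  by exists 0%N, 0%N, [::]; split; rewrite ?big_nil.
have [|U [L [s [sw gE mUL UL sUL]]]] := IH.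
  by move=> y yw; apply: w1; rewrite inE yw orbT.
have := w1 x; rewrite inE eqxx => /(_ isT) x1.
rewrite semidirect_prod_cons/= gE.
move: (\prod_(y <- w) y)%g.1 mUL UL => m mUL UL.
have [U' [L' [UU' LL' xmUL UL']]] := walk_step x1 mUL UL.
exists U', L', ((m, x.2) :: s); split=> //=.
- by rewrite sw.
- by rewrite big_cons.
- have widen (i : int) : - L%:Z <= i <= U%:Z -> - L'%:Z <= i <= U'%:Z by lia.
  move=> q; rewrite inE => /predU1P[-> /=|/sUL [qUL [y yw qy]]].
    by split; [exact: widen | exists x; rewrite ?inE ?eqxx].
  by split; [exact: widen | exists y; rewrite // inE yw orbT].
Qed.

(** [U] and [L] are chosen before [I], so that the same range can be compared with both functions of
    a pair. *)
Lemma word_bounds w : (forall x, x \in w -> `|x.1|%R <= 1) ->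
  exists U L : nat,
    [/\ - L%:Z <= (\prod_(y <- w) y)%g.1 <= U%:Z,
        (2 * (U + L) <= size w + `|(\prod_(y <- w) y)%g.1|)%N
      & forall (R : realType) (C c M u : R) (I : K -> R) d,
          0 <= C -> quasi_valuation C c I -> (size w <= 2 ^ d)%N ->
          (forall x, x \in w -> val_le I M x.2) ->
          (forall i : int, - L%:Z <= i <= U%:Z -> c * i%:~R <= u) ->
          val_le I (M + u + C * d%:R) (\prod_(y <- w) y)%g.2].
Proof.
move=> /word_walk[U [L [s [sw gE mUL UL sUL]]]]; exists U, L; split=> //.
move=> R C c M u I d C0 qI wd wM cu; rewrite gE.
rewrite -(big_map (fun q => tpow q.1 *: q.2) xpredT id).
apply: (val_le_sum C0 qI); first by rewrite size_map sw.
move=> _ /mapP[q /sUL[qUL [x xw ->]] ->].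
apply: val_leW (val_le_tpow qI (wM x xw)).
by rewrite lerD2l cu.
Qed.

(** First coordinates of the suffix products: a lamp inserted in front of a suffix is multiplied by
    the power of [t] belonging to that suffix. *)
Fixpoint visited w : seq int :=
  (\prod_(y <- w) y)%g.1 :: if w is _ :: w' then visited w' else [::].

Lemma mem_visited w : (\prod_(y <- w) y)%g.1 \in visited w.
Proof. by case: w => [|x w]; rewrite inE eqxx. Qed.

Section Tour.
Variable A : set K.
Hypothesis (A0 : A 0).
Hypothesis (AN : forall a, A a -> A (- a)).

Notation word := (is_word (semidirect_gens A)).

Lemma semidirect_gens_in a : A a -> semidirect_gens A (sd_in a).
Proof. by move=> Aa; right; exists a. Qed.

Lemma semidirect_gens_edge a a' :
  A a -> A a' -> semidirect_gens A (1, tpow 1 *: a + a').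
Proof.
move=> Aa Aa'; left; exists a => //; exists a' => //.
by rewrite !semidirect_mulE/= !(addr0, add0r) tpow0 scale1r.
Qed.

(** A step backwards is the inverse of the generator [0 t (-a)]; this is where the symmetry of [A]
    enters. *)
Lemma semidirect_step (e : int) a : `|e|%N = 1%N -> A a ->
  let x := (e, tpow e *: a) : semidirect K in
  semidirect_gens A x \/ semidirect_gens A (x^-1)%g.
Proof.
move=> e1 Aa /=; have [->|->] : e = 1 \/ e = -1 by lia.
  by left; rewrite -[tpow 1 *: a]addr0; exact: semidirect_gens_edge.
right.
have -> : (((-1, tpow (-1) *: a) : semidirect K)^-1)%g
   = (1, tpow 1 *: 0 + - a) :> semidirect K.
  rewrite /(_^-1)%g/= /sd_inv/= scalerA -tpowD addrN tpow0 scale1r.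
  by rewrite scaler0 add0r opprK.
exact: semidirect_gens_edge (AN Aa).
Qed.

Lemma word_segment (e : int) (f : nat -> K) n w :
  `|e|%N = 1%N -> (forall j, A (f j)) -> word w ->
  let g := (\prod_(y <- w) y)%g in
  exists w', [/\ word w', size w' = (size w + n)%N,
    (\prod_(y <- w') y)%g = (g.1 + e * n%:Z,
       g.2 + \sum_(j < n) tpow (g.1 + e * j.+1%:Z) *: f j),
    {subset visited w <= visited w'}
    & forall j, (j < n)%N -> g.1 + e * j.+1%:Z \in visited w'].
Proof.
move=> e1 Af Sw g; elim: n => [|n [w' [Sw' sw' gw' vw' jw']]].
  exists w; split; rewrite ?addn0//.
  by rewrite big_ord0 addr0 mulr0 addr0 -/g; case: (g).
pose x := (e, tpow e *: f n) : semidirect K.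
have gx : (\prod_(y <- x :: w') y)%g = (g.1 + e * n.+1%:Z,
       g.2 + \sum_(j < n.+1) tpow (g.1 + e * j.+1%:Z) *: f j) :> semidirect K.
  have hE : g.1 + e * n%:Z + e = g.1 + e * n.+1%:Z.
    by rewrite -addn1 PoszD mulrDr mulr1 addrA.
  rewrite semidirect_prod_cons gw'/= scalerA -tpowD hE addrC hE.
  by congr pair; rewrite big_ord_recr/= [LHS]addrC addrA.
exists (x :: w'); split=> //.
- by apply: is_word_cons => //; exact: semidirect_step.
- by rewrite /= sw' addnS.
- by move=> i /vw' iw'; rewrite /= inE iw' orbT.
move=> j; rewrite ltnS leq_eqVlt => /predU1P[->|/jw' jw].
  by have := mem_visited (x :: w'); rewrite gx.
by rewrite /= inE jw orbT.
Qed.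

(* Go from 0 to -eP, then to eQ and back to em, lighting the lamps on the
   second segment only. *)
Lemma word_tour (e : int) (f : int -> K) (P Q m : nat) :
  `|e|%N = 1%N -> (forall i, A (f i)) -> (m <= Q)%N ->
  let h (j : nat) := e * (j.+1%:Z - P%:Z) in
  exists w, [/\ word w, (size w + m = 2 * (P + Q))%N,
    (\prod_(y <- w) y)%g =
      (e * m%:Z, \sum_(j < P + Q) tpow (h j) *: f (h j)) :> semidirect K
    & forall j, (j < P + Q)%N -> h j \in visited w].
Proof.
move=> e1 Af mQ h.
have Ne1 : `|- e|%N = 1%N by lia.
have S0 : word [::] by [].
have zero n (F : 'I_n -> int) : \sum_(j < n) tpow (F j) *: (0 : K) = 0.
  by rewrite big1// => j _; rewrite scaler0.
have [w1 [Sw1 sw1 gw1 _ _]] := word_segment P Ne1 (fun=> A0) S0.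
have nil0 : (\prod_(y <- [::]) y)%g = (0, 0) :> semidirect K by rewrite big_nil.
rewrite zero nil0/= add0r addr0 in gw1 sw1.
have [w2 [Sw2 sw2 gw2 _ vw2]] :=
  word_segment (P + Q) e1 (fun j => Af (h j)) Sw1.
have [w3 [Sw3 sw3 gw3 vw3 _]] := word_segment (Q - m) Ne1 (fun=> A0) Sw2.
have hE j : - e * P%:Z + e * j.+1%:Z = h j.
  by rewrite /h mulrBr mulNr addrC.
exists w3; split=> //.
- rewrite sw3 sw2 sw1; lia.
- rewrite gw3 gw2 gw1/= zero addr0 add0r; congr pair.
    by rewrite -subzn// PoszD; ring.
  by apply: eq_bigr => j _; rewrite hE.
- by move=> j /vw2; rewrite gw1/= hE => /vw3.
Qed.

(** The letter [sd_in c] goes in front of a suffix whose first coordinate is [i]. It does not move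
    the walk, so the visited positions remain available for further insertions. *)
Lemma word_insert w i c : word w -> A c -> i \in visited w ->
  exists w', [/\ word w', size w' = (size w).+1,
    (\prod_(y <- w') y)%g = ((\prod_(y <- w) y)%g.1,
       (\prod_(y <- w) y)%g.2 + tpow i *: c) :> semidirect K
    & {subset visited w <= visited w'}].
Proof.
move=> + Ac; elim: w => [|x w IH] Sw.
  rewrite inE => /eqP ->; exists [:: sd_in c]; split=> //.
  - by apply: is_word_cons => //; left; exact: semidirect_gens_in.
  - by rewrite semidirect_prod_cons/= big_nil/= add0r addr0 add0r.
  - by move=> j; rewrite /= !inE big_nil => ->; rewrite orbT.
rewrite inE; have [ix _|_ /= iw] := eqVneq i (\prod_(y <- x :: w) y)%g.1.
  exists (sd_in c :: x :: w); split=> //.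
  - by apply: is_word_cons => //; left; exact: semidirect_gens_in.
  - by rewrite semidirect_prod_cons/= add0r -ix addrC.
  - by move=> j jw; rewrite [visited _]/= inE jw orbT.
have [|w' [Sw' sw' gw' vw']] := IH _ iw.
  by move=> y yw; apply: Sw; rewrite inE yw orbT.
exists (x :: w'); split=> //.
- by apply: is_word_cons => //; apply: Sw; rewrite inE eqxx.
- by rewrite /= sw'.
- by rewrite !semidirect_prod_cons gw'/= addrA.
- move=> j; rewrite /= !inE !semidirect_prod_cons gw'/=.
  by case/orP => [->//|/vw' ->]; rewrite orbT.
Qed.

Lemma word_inserts w n (ij : 'I_n -> int) (c : 'I_n -> K) :
  word w -> (forall j, A (c j)) -> (forall j, ij j \in visited w) ->
  exists w', [/\ word w', size w' = (size w + n)%N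
    & (\prod_(y <- w') y)%g = ((\prod_(y <- w) y)%g.1,
       (\prod_(y <- w) y)%g.2 + \sum_(j < n) tpow (ij j) *: c j)
       :> semidirect K].
Proof.
elim: n ij c w => [|n IH] ij c w Sw Ac vw.
  by exists w; rewrite addn0 big_ord0 addr0; split=> //; case: (\prod_(y <- w) y)%g.
have [w1 [Sw1 sw1 gw1 vw1]] := word_insert Sw (Ac ord0) (vw ord0).
have [j|j|w2 [Sw2 sw2 gw2]] :=
  IH (fun j => ij (lift ord0 j)) (fun j => c (lift ord0 j)) w1 Sw1.
- exact: Ac.
- exact/vw1/vw.
exists w2; split=> //; first by rewrite sw2 sw1 addSnnS.
by rewrite gw2 gw1 big_ord_recl addrA.
Qed.

Lemma fsbig_segment (V : zmodType) (F : int -> V) (h : nat -> int) n :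
  injective h -> (forall i, F i != 0 -> exists2 j, (j < n)%N & h j = i) ->
  \sum_(i \in [set: int]) F i = \sum_(j < n) F (h j).
Proof.
move=> h_inj supp; rewrite (fsbig_ord _ n (F \o h)).
rewrite -(@fsbig_image _ _ _ _ _ `I_n h F); last by move=> i j _ _ /h_inj.
apply/esym/fsbig_widen => // i [_ /= im].
apply: contrapT => /eqP /supp[j jn ji]; apply: im; by exists j.
Qed.

Lemma word_window (n L U : nat) (m : int) (a : int -> K)
    (ij : 'I_n -> int) (c : 'I_n -> K) :
  (forall i, A (a i)) -> (forall j, A (c j)) ->
  (forall i, a i != 0 -> - L%:Z <= i <= U%:Z) ->
  (forall j, - L%:Z <= ij j <= U%:Z) -> - L%:Z <= m <= U%:Z ->
  exists w, [/\ word w, (size w + `|m| = 2 * (L + U).+1 + n)%N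
    & (\prod_(y <- w) y)%g =
        (m, \sum_(i \in [set: int]) (tpow i *: a i)
            + \sum_(j < n) tpow (ij j) *: c j) :> semidirect K].
Proof.
move=> Aa Ac supp iL mL.
suff [w [Sw sw gw vw]] : exists w, [/\ word w,
    (size w + `|m| = 2 * (L + U).+1)%N,
    (\prod_(y <- w) y)%g = (m, \sum_(i \in [set: int]) (tpow i *: a i))
      :> semidirect K
    & forall i : int, - L%:Z <= i <= U%:Z -> i \in visited w].
  have [w' [Sw' sw' gw']] := word_inserts Sw Ac (fun j => vw _ (iL j)).
  exists w'; split=> //; first by rewrite sw'; lia.
  by rewrite gw' gw.
suff tour e P Q : `|e|%N = 1%N -> (P + Q = (L + U).+1)%N -> e * m = `|m|%N%:Z ->
    (`|m| <= Q)%N ->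
    (forall i : int, - L%:Z <= i <= U%:Z ->
       exists2 j, (j < P + Q)%N & e * (j.+1%:Z - P%:Z) = i) ->
  exists w, [/\ word w,
    (size w + `|m| = 2 * (L + U).+1)%N,
    (\prod_(y <- w) y)%g = (m, \sum_(i \in [set: int]) (tpow i *: a i))
      :> semidirect K
    & forall i : int, - L%:Z <= i <= U%:Z -> i \in visited w].
  have [m0|m0] := leP 0 m.
    (* A tour lights its lamps on arrival, hence not at its first turning point. It turns at
       [-L - 1] so that [-L] is lit; for negative [m] the picture is reflected. *)
    apply: (tour 1 L.+1 U); rewrite ?mul1r//; try lia.
    by move=> i iLU; exists `|(i + L%:Z)%R|%N; lia.
  apply: (tour (-1) U.+1 L); rewrite ?mulN1r//; try lia.
  by move=> i iLU; exists `|(U%:Z - i)%R|%N; lia.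
move=> e1 PQ em mQ cover.
have ee : e * e = 1.
  by have [->|->] : e = 1 \/ e = -1 by lia.
have [w [Sw sw gw vw]] := word_tour P e1 Aa mQ.
exists w; split=> //; first by rewrite sw PQ.
  rewrite gw; congr pair; first by rewrite -em mulrA ee mul1r.
  rewrite (@fsbig_segment _ _ (fun j => e * (j.+1%:Z - P%:Z)) (P + Q))//.
    move=> i j /(congr1 ( *%R e)); rewrite !mulrA ee !mul1r; lia.
  move=> i ai; apply/cover/supp; apply: contraNneq ai => ->.
  by rewrite scaler0.
by move=> i /cover[j /vw + <-].
Qed.

End Tour.

End Words.

(** * Two auxiliary bounds *)

Lemma finite_set_bounded (R : realType) (T : choiceType) (A : set T) (f : T -> R) :
  finite_set A -> exists M, forall a, A a -> f a <= M.
Proof.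
case/finite_seqP => s ->; exists (\sum_(x <- s) `|f x|) => a /= /[dup] sa.
rewrite (big_rem a)//= => _; apply: le_trans (ler_norm _) _.
by rewrite lerDl sumr_ge0.
Qed.

Lemma lin_lt_expn2 (u v : nat) : exists q, (u * q + v < 2 ^ q)%N.
Proof.
pose s := (2 * u + v)%N; exists (s + s)%N.
have s2 : (s < 2 ^ s)%N by rewrite ltn_expl.
have : (s.+1 * s.+1 <= 2 ^ (s + s))%N by rewrite expnD leq_mul.
rewrite /s; nia.
Qed.

(** * Pairs of valuations, good generating sets and short words near the peaks *)

Section Pairs.
Variables (R : realType) (K : lmodType laurent).

Lemma pair_qv1 (C b : R) (I1 I2 : K -> R) :
  pair_of_valuations C b I1 I2 -> quasi_valuation C b I1.
Proof. by case. Qed.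

Lemma pair_qv2 (C b : R) (I1 I2 : K -> R) :
  pair_of_valuations C b I1 I2 -> quasi_valuation C (- b) I2.
Proof. by case. Qed.

Lemma pair_swap (C b : R) (I1 I2 : K -> R) :
  pair_of_valuations C b I1 I2 -> pair_of_valuations C (- b) I2 I1.
Proof. by case=> *; split=> // k k0; rewrite ?opprK; auto. Qed.

Lemma pairW (C C' b : R) (I1 I2 : K -> R) : C <= C' ->
  pair_of_valuations C b I1 I2 -> pair_of_valuations C' b I1 I2.
Proof.
move=> CC' [t1 t2 o1 o2 a1 a2]; split=> // k1 k2 k10 k20 k0.
  by apply: le_trans (a1 _ _ k10 k20 k0) _; rewrite lerD2l.
by apply: le_trans (a2 _ _ k10 k20 k0) _; rewrite lerD2l.
Qed.

Lemma in_window_swap (b : R) (I1 I2 : K -> R) F' k i :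
  in_window (- b) I2 I1 F' k i = in_window b I1 I2 F' k i.
Proof.
have minE (u v w : R) : (Num.min (- u) 0 - w <= v) = (- v <= Num.max u 0 + w).
  by rewrite -[RHS]lerN2 opprK opprD oppr_max oppr0.
by rewrite /in_window !minE mulNr opprK andbC.
Qed.

Lemma good_generating_set_swap (b F : R) (I1 I2 I1' I2' : K -> R) F' A :
  good_generating_set b I1 I2 I1' I2' F F' A ->
  good_generating_set (- b) I2 I1 I2' I1' F F' A.
Proof.
case=> A0 AN Ale Adec; split=> //; first by move=> a Aa /(Ale _ Aa)[].
move=> k k0 k1 k2; have [a [ij [c [Aac a0 ks ijw]]]] := Adec k k0 k2 k1.
exists a, ij, c; split=> // [i|j]; last by rewrite in_window_swap.
by rewrite in_window_swap; exact: a0.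
Qed.

(** One [b] comes from the [t] in [a t a'], the other from inverting the letter, which turns the
    second coordinate [k] into [-t^(-m) k]; [C] comes from adding the two lamps. *)
Lemma semidirect_gens_bounds (b C M : R) (A : set K) (x : semidirect K) :
  0 < b -> 0 <= C ->
  semidirect_gens A x \/ semidirect_gens A (x^-1)%g ->
  `|x.1|%R <= 1 /\ forall (c : R) I, `|c| <= b -> quasi_valuation C c I ->
    (forall a, A a -> val_le I M a) -> val_le I (M + 2 * b + C) x.2.
Proof.
move=> b0 C0.
have gen y : semidirect_gens A y -> `|y.1|%R <= 1 /\
    forall (c : R) I, `|c| <= b -> quasi_valuation C c I ->
    (forall a, A a -> val_le I M a) -> val_le I (M + b + C) y.2.
  case=> [[a Aa [a' Aa' <-]]|[a Aa <-]]; split=> // c I.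
    rewrite ler_norml => /andP[_ cb] qI AM.
    rewrite !semidirect_mulE/= !(addr0, add0r) tpow0 scale1r.
    apply: (val_leD C0 qI); last by apply: val_leW (AM _ Aa'); lra.
    by apply: val_leW (val_le_tpow qI (AM _ Aa)); rewrite mulr1; lra.
  by move=> _ _ AM; apply: val_leW (AM _ Aa); lra.
case=> [/gen[x1 xM]|/gen[x1 xM]]; split=> //.
- by move=> c I cb qI AM; apply: val_leW (xM c I cb qI AM); lra.
- by move: x1; rewrite normrN.
move=> c I cb qI AM; have := xM c I cb qI AM.
have -> : x.2 = ((x^-1)^-1)%g.2 by rewrite invgK.
case: (x^-1)%g x1 => m k m1 kM.
apply: (val_leN qI); apply: val_leW (val_le_tpow qI kM).
have : `|c * (- m)%:~R| <= b.
  rewrite normrM -[b]mulr1 ler_pM//.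
  by move: m1; rewrite -intr_norm normrN -(ler_int R).
rewrite ler_norml => /andP[_]; lra.
Qed.

(* With F = 4C, the elements t^m(t^p a + t^-p a) + x with x small satisfy the
   hypothesis of [ggs_decomp], as both of I1 and I1' are within 2C of their
   values at t^(m+p) a. *)
Lemma peaks_word (b C M B : R) (I1 I2 I1' I2' : K -> R) (A : set K)
    (F' kappa p : nat) (a x : K) (m : int) :
  0 < b -> 0 <= C ->
  pair_of_valuations C b I1 I2 -> pair_of_valuations C b I1' I2' ->
  good_generating_set b I1 I2 I1' I2' (4 * C) F' A ->
  (forall I, [\/ I = I1, I = I2, I = I1' | I = I2'] ->
     `|I a| <= M /\ val_le I B x) ->
  A a -> a != 0 ->
  M + 2 * C + F'%:R <= b * kappa%:R -> C < b * p%:R -> (`|m| <= p)%N ->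
  B + 2 * C + M < b * p%:R - b * `|m|%N%:R ->
  exists w, [/\ is_word (semidirect_gens A) w,
    (size w + `|m| = 4 * p + 4 * kappa + 2 + F')%N
    & (\prod_(y <- w) y)%g = (m, tpow m *: peaks a p%:Z + x) :> semidirect K].
Proof.
move=> b0 C0 pI pI' gA bnd Aa a0 kappaP pP mp mP.
(* The range is [[m - p, m + p]], widened at both ends by [kappa] to absorb [M], [2 * C] and
   [F']. *)
have [U [L [UZ LZ mUL LU]]] : exists U L : nat,
    [/\ U%:Z = p%:Z + m + kappa%:Z, L%:Z = p%:Z - m + kappa%:Z,
       - L%:Z <= m <= U%:Z & (L + U = 2 * p + 2 * kappa)%N].
  clear -mp; exists `|(p%:Z + m + kappa%:Z)%R|%N.
  by exists `|(p%:Z - m + kappa%:Z)%R|%N; split; lia.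
set y := tpow m *: peaks a p%:Z + x.
have /andP[bm' bm] : - (b * `|m|%N%:R) <= b * m%:~R <= b * `|m|%N%:R.
  rewrite -mulrN !ler_pM2l// natr_absz intr_norm.
  by rewrite ler_norm andbT -lerN2 opprK -normrN ler_norm.
have up I : quasi_valuation C b I -> `|I a| <= M -> val_le I B x ->
    y != 0 /\ b * p%:R + b * m%:~R + I a - 2 * C <= I y
              <= b * p%:R + b * m%:~R + I a + 2 * C.
  rewrite ler_norml => qI /andP[Ia _] xB.
  by apply: (@peaks_bounds _ _ C b B M _ _ _ I a x p%:Z m) => //; lra.
have down I : quasi_valuation C (- b) I -> `|I a| <= M -> val_le I B x ->
    y != 0 /\ b * p%:R + - (b * m%:~R) + I a - 2 * C <= I y
              <= b * p%:R + - (b * m%:~R) + I a + 2 * C.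
  rewrite ler_norml => qI /andP[Ia _] xB.
  (* Under a function with constant [-b] the peak at [-p] dominates; the symmetry of [peaks] lets it
     take the place of the one at [p]. *)
  rewrite /y -peaksN.
  apply: (@peaks_bounds _ _ C (- b) B M _ _ _ I a x (- p%:Z) m) => //; lra.
have [I1a I1x] := bnd I1 (Or41 _ _ _ erefl).
have [I2a I2x] := bnd I2 (Or42 _ _ _ erefl).
have [I1'a I1'x] := bnd I1' (Or43 _ _ _ erefl).
have [I2'a I2'x] := bnd I2' (Or44 _ _ _ erefl).
have [y0 /andP[I1y I1y']] := up I1 (pair_qv1 pI) I1a I1x.
have [_ /andP[I2y I2y']] := down I2 (pair_qv2 pI) I2a I2x.
have [_ /andP[_ I1'y]] := up I1' (pair_qv1 pI') I1'a I1'x.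
have [_ /andP[_ I2'y]] := down I2' (pair_qv2 pI') I2'a I2'x.
have [leI1 leI2] := ggs_le gA Aa a0.
have [||a_ [ij [c [[Aa_ Ac] a_0 ksum ijw]]]] := ggs_decomp gA y0.
- lra.
- lra.
have UE : b * (U%:Z)%:~R = b * p%:R + b * m%:~R + b * kappa%:R.
  by rewrite UZ !intrD !mulrDr.
have LE : b * (L%:Z)%:~R = b * p%:R - b * m%:~R + b * kappa%:R.
  by rewrite LZ !intrD mulrNz !mulrDr mulrN.
have window i : in_window b I1 I2 F' y i -> - L%:Z <= i <= U%:Z.
  have M0 := le_trans (normr_ge0 _) I1a.
  move: I1a I2a; rewrite !ler_norml => /andP[_ I1a] /andP[_ I2a].
  (* This takes care of the 0 in the minimum and the maximum that define the window. *)
  have p0 : 0 <= b * p%:R - b * `|m|%N%:R.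
    by rewrite subr_ge0 ler_pM2l// ler_nat.
  have F0 : 0 <= F'%:R :> R by [].
  clear -b0 C0 M0 p0 F0 bm bm' kappaP I1a I2a I1y' I2y' UE LE.
  case/andP => lo hi; apply/andP; split; rewrite -(ler_int R) -(ler_pM2l b0).
    rewrite mulrNz mulrN LE; apply: le_trans lo.
    by rewrite lerBrDr le_min; apply/andP; split; lra.
  by rewrite UE; apply: le_trans hi _; rewrite -lerBrDr ge_max; apply/andP; split; lra.
have AN k : A k -> A (- k) by move=> Ak; rewrite -(ggs_opp gA); exists k.
have [|||w [Sw sw gw]] := @word_window K A (ggs_0 gA) AN F' L U m a_ ij c Aa_ Ac.
- move=> i ai; apply: window; apply: contraNT ai => /a_0 ->; exact: eqxx.
- by move=> j; exact/window/ijw.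
- exact: mUL.
exists w; split=> //; first by rewrite sw LU; clear; lia.
by rewrite gw -ksum addrC subrK.
Qed.

End Pairs.

(** * The choice of scale and the proof of deep pockets *)

Lemma choose_scale (N kappa D1 : nat) : exists p d : nat,
  (4 * p + D1 <= 2 ^ d)%N /\
  (2 * (N * (D1 + 4 * kappa * d.+1).+1) + kappa * d + 2 * kappa < p)%N.
Proof.
(* Taking [p = 2 ^ q] and [d = q + 3] makes [p] outgrow all errors, which are linear in [d], while
   [2 ^ d = 8 * p] still exceeds the lengths [4 * p + D1]. *)
have [q qP] := lin_lt_expn2 (8 * N * kappa + kappa)
  (2 * N * (D1 + 16 * kappa + 1) + 5 * kappa + D1).
exists (2 ^ q)%N, q.+3; rewrite !expnS; move: (2 ^ q)%N qP => p qP; split; nia.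
Qed.

Lemma deep_pockets_pos (R : realType) (b C : R) (K : lmodType laurent)
    (I1 I2 I1' I2' : K -> R) (A : set K) (F' : nat) :
  0 < b -> 0 <= C ->
  pair_of_valuations C b I1 I2 -> pair_of_valuations C b I1' I2' ->
  finite_set A -> good_generating_set b I1 I2 I1' I2' (4 * C) F' A ->
  (exists2 a, A a & a != 0) ->
  has_deep_pockets (semidirect_gens A).
Proof.
move=> b0 C0 pI pI' finA gA [a Aa a0].
pose four I := [\/ I = I1, I = I2, I = I1' | I = I2'].
pose norm4 k := `|I1 k| + `|I2 k| + `|I1' k| + `|I2' k|.
have norm4P I k : four I -> `|I k| <= norm4 k.
  have := (normr_ge0 (I1 k), normr_ge0 (I2 k), normr_ge0 (I1' k), normr_ge0 (I2' k)).
  by rewrite /norm4 => -[[[h1 h2] h3] h4] [] ->; lra.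
have four_qv I : four I -> exists2 c, `|c| <= b & quasi_valuation C c I.
  have bb : `|b| <= b by rewrite gtr0_norm.
  have Nb : `|- b| <= b by rewrite normrN.
  case=> ->; [exists b|exists (- b)|exists b|exists (- b)] => //.
  - exact: pair_qv1 pI.
  - exact: pair_qv2 pI.
  - exact: pair_qv1 pI'.
  - exact: pair_qv2 pI'.
have [M MA] := finite_set_bounded norm4 finA.
have M0 : 0 <= M by apply: le_trans (MA a Aa); rewrite !addr_ge0.
have IM I k : four I -> A k -> `|I k| <= M.
  by move=> fI Ak; apply: le_trans (norm4P _ _ fI) (MA _ Ak).
have [M' M'E] : exists M', M' = M + 2 * b + C by exists (M + 2 * b + C).
have F0 : 0 <= F'%:R :> R by [].
(* A single integer absorbs all additive constants; in particular the tree error [C * d] is at most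
   [b * kappa * d]. *)
have [kappa kappaP] : exists kappa : nat, M' + 2 * C + M + F'%:R <= b * kappa%:R.
  exists (Num.bound ((M' + 2 * C + M + F'%:R) / b)).
  by rewrite [leRHS]mulrC -ler_pdivrMr//; apply/ltW/archi_boundP/divr_ge0; lra.
have Ckappa : C <= b * kappa%:R by lra.
have AN k : A k -> A (- k) by move=> Ak; rewrite -(ggs_opp gA); exists k.
pose S := semidirect_gens A.
have gens_bnd x : S x \/ S (x^-1)%g ->
    `|x.1|%R <= 1 /\ forall I, four I -> val_le I M' x.2.
  move=> /(semidirect_gens_bounds M b0 C0)[x1 xM]; split=> // I fI.
  have [c cb qI] := four_qv I fI; rewrite M'E; apply: xM cb qI _ => // k Ak _.
  exact: le_trans (ler_norm _) (IM _ _ fI Ak).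
have bounds w : is_word S w -> exists U L : nat,
    [/\ - L%:Z <= (\prod_(y <- w) y)%g.1 <= U%:Z,
        (2 * (U + L) <= size w + `|(\prod_(y <- w) y)%g.1|)%N
      & forall c I u d, four I -> quasi_valuation C c I -> (size w <= 2 ^ d)%N ->
          (forall i : int, - L%:Z <= i <= U%:Z -> c * i%:~R <= u) ->
          val_le I (M' + u + C * d%:R) (\prod_(y <- w) y)%g.2].
  move=> Sw; have [x /Sw/gens_bnd[]//|U [L [mUL UL wUL]]] := @word_bounds K w.
  exists U, L; split=> // c I u d fI qI wd cu.
  by apply: wUL wd _ cu => // x /Sw/gens_bnd[_]; apply.
have upper a' B p (m : int) x : A a' -> a' != 0 ->
    (forall I, four I -> val_le I B x) -> C < b * p%:R -> (`|m| <= p)%N ->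
    B + 2 * C + M < b * p%:R - b * `|m|%N%:R ->
    exists w, [/\ is_word S w, (size w + `|m| = 4 * p + 4 * kappa + 2 + F')%N
      & (\prod_(y <- w) y)%g = (m, tpow m *: peaks a' p%:Z + x) :> semidirect K].
  move=> Aa' a'0 xB; apply: (peaks_word b0 C0 pI pI' gA _ Aa' a'0).
    by move=> I fI; split; [exact: IM | exact: xB].
  lra.
(* For large [p], both [(0, peaks (-a) p)] and [(m, t^m peaks a p + k)] are words by [upper]. In
   their product the peaks cancel and [(m, k)] remains. *)
have genS : generates S.
  case=> m k.
  have [B [B0 Bk]] : exists B, 0 <= B /\ forall I, four I -> val_le I B k.
    exists (norm4 k); split; first by rewrite !addr_ge0.
    by move=> I fI _; apply: le_trans (ler_norm _) (norm4P _ _ fI).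
  have m0 : 0 <= b * `|m|%N%:R by rewrite mulr_ge0// ltW.
  have [p Xp] : exists p : nat, B + 2 * C + M + C + b * `|m|%N%:R < b * p%:R.
    exists (Num.bound ((B + 2 * C + M + C + b * `|m|%N%:R) / b)).
    by rewrite [ltRHS]mulrC -ltr_pdivrMr//; apply/archi_boundP/divr_ge0; lra.
  have mp : (`|m| <= p)%N.
    by rewrite -(ler_nat R) -(ler_pM2l b0); lra.
  have [||u [Su _ gu]] := @upper a B p m k Aa a0 Bk _ mp; try lra.
  have [|||||v [Sv _ gv]] := @upper (- a) 0 p 0 0 (AN _ Aa).
  - by rewrite oppr_eq0.
  - by move=> I _; exact: val_le0.
  - by lra.
  - by [].
  - by rewrite absz0 mulr0; lra.
  exists (v ++ u); first exact: is_word_cat.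
  rewrite big_cat/= gu gv semidirect_mulE/= add0r; congr pair.
  rewrite tpow0 scale1r addr0 addrA -scalerDr /peaks !scalerN addrACA !addNr.
  by rewrite addr0 scaler0 add0r.
apply: deep_pockets_criterion => //.
  (* Each letter moves the first coordinate by at most 1, so this element has length greater than
     [n]. *)
  move=> n; exists (n.+1%:Z, 0).
  have [w [Sw gw <-]] := word_length_attained genS ((n.+1%:Z, 0) : semidirect K).
  by have [U [L [+ + _]]] := bounds w Sw; rewrite -gw /=; clear; lia.
move=> N; pose D1 := (4 * kappa + 2 + F')%N.
have [p [d [pd]]] := choose_scale N kappa D1.
(* [D1] is the excess over [4 * p] in the upper bound for the length of [gh]; the other summand is
   the deficit in the lower bound for the length of [g]. *)
set D := (D1 + 4 * kappa * d.+1)%N => pN.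
exists (sd_in (peaks a p%:Z)), D => h.
move: (N * D.+1)%N pN => N' pN.
have kp : b * kappa%:R < b * p%:R.
  by rewrite ltr_pM2l// ltr_nat; clear -pN; lia.
have Cp : C < b * p%:R by lra.
have Cd : C * d%:R <= b * kappa%:R * d%:R by rewrite ler_wpM2r.
have short h' : (word_length S h' <= N')%N ->
    (word_length S (sd_in (peaks a p%:Z) * h')%g <= 4 * p + D1)%N.
  have [w [Sw -> <-]] := word_length_attained genS h'.
  have [U [L [mUL UL wUL]]] := bounds w Sw => wN.
  move: mUL UL wUL; set g := (\prod_(y <- w) y)%g; case: g => m x /= mUL UL wUL.
  have [ULN mN] : (U + L <= N')%N /\ (`|m| <= N')%N.
have := leq_trans UL (leq_add wN (leqnn _)); clear -mUL; split; lia.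
  have xB I : four I -> val_le I (M' + b * N'%:R + C * d%:R) x.
    move=> fI; have [c cb qI] := four_qv I fI.
    apply: (wUL c I _ d fI qI); first by apply: leq_trans wN _; clear -pN pd; lia.
    move=> i iUL; apply: le_trans (ler_norm _) _.
    rewrite normrM -intr_norm ler_pM//.
    by rewrite -natr_absz ler_nat; clear -iUL ULN; lia.
  have [||v [Sv sv gv]] := upper a _ p m x Aa a0 xB Cp; first by clear -mN pN; lia.
    have h1 : b * (2 * (N') + kappa * d + kappa)%N%:R < b * p%:R.
      by rewrite ltr_pM2l// ltr_nat; clear -pN; lia.
    have h2 : b * `|m|%N%:R <= b * N'%:R by rewrite ler_pM2l// ler_nat.
    move: h1; rewrite !(natrD, natrM).
    move: h2 Cd kappaP F0; clear; lra.
  have -> : (sd_in (peaks a p%:Z) * (m, x))%g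
     = (\prod_(y <- v) y)%g by rewrite gv semidirect_mulE/= add0r.
  apply: leq_trans (word_length_le Sv) _.
  by rewrite -(leq_add2r `|m|) sv /D1; clear; lia.
move=> /short /leq_trans; apply.
have wl1 : word_length S 1%g = 0%N.
  apply/eqP; rewrite -leqn0.
  have S0 : is_word S [::] by [].
  by have := word_length_le S0; rewrite big_nil.
(* With [h' = 1] the upper bound applies to [g] itself, so a shortest word for [g] has at most
   [2 ^ d] letters and its tree has depth at most [d]. *)
have := @short 1%g; rewrite mulg1 wl1 => /(_ isT).
have [w [Sw gw <-]] := word_length_attained genS (sd_in (peaks a p%:Z)).
move=> wp; have [U [L []]] := bounds w Sw; rewrite -gw /= => _ UL wUL.
have wd : (size w <= 2 ^ d)%N by apply: leq_trans wp pd.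
(* The peak dominant under [I] gives a value of at least [b * p + I a - 2 * C], whereas a walk
   reaching only [V] in its direction gives at most [M' + b * V + C * d]. The sign [e] selects the
   peak. *)
have reach (c : R) I (V : nat) (e : int) : four I -> quasi_valuation C c I ->
    c * (e * p%:Z)%:~R = b * p%:R -> e = 1 \/ e = -1 ->
    (forall i : int, - L%:Z <= i <= U%:Z -> c * i%:~R <= b * V%:R) ->
    (p <= V + kappa * d.+1)%N.
  move=> fI qI cp e1 cV.
  have := IM I a fI Aa; rewrite ler_norml => /andP[Ia _].
  have pE : peaks a p%:Z = tpow 0 *: peaks a (e * p%:Z) + 0.
    rewrite tpow0 scale1r addr0.
    by case: e1 => ->; rewrite ?mul1r// mulN1r peaksN.
  have small : 0 + 2 * C + M < b * p%:R + 0 by lra.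
  have [y0 /andP[ylo _]] := @peaks_bounds R K C c 0 M _ _ _ I a 0 (e * p%:Z) 0
    C0 qI cp (mulr0 _) erefl a0 Ia Cp small (@val_le0 _ _ _ _).
  rewrite -pE in y0 ylo.
  have yhi := wUL c I _ d fI qI wd cV y0.
  rewrite -(ler_nat R) -(ler_pM2l b0) natrD natrM -addn1 natrD.
  rewrite mulrDr mulrA [_ * (_ + 1)]mulrDr mulr1.
  move: ylo yhi Ia Cd kappaP F0; clear; lra.
have pU : (p <= U + kappa * d.+1)%N.
  apply: (reach b I1 U 1); [by apply: Or41|exact: pair_qv1 pI| |by left|].
    by rewrite mul1r.
  by move=> i /andP[_ iU]; rewrite ler_pM2l// -[_%:R]/(U%:Z%:~R) ler_int.
have pL : (p <= L + kappa * d.+1)%N.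
  apply: (reach (- b) I2 L (-1)); [by apply: Or42|exact: pair_qv2 pI| |by right|].
    by rewrite mulN1r mulrNz mulrNN.
  move=> i /andP[iL _]; rewrite mulNr -mulrN ler_pM2l// -mulrNz.
  by rewrite -[_%:R]/(L%:Z%:~R) ler_int lerNl.
have {}UL : (2 * (U + L) <= size w + 0)%N := UL.
rewrite addn0 in UL.
apply: (@leq_trans (2 * (U + L) + 4 * kappa * d.+1 + D1)).
  by clear -pU pL; lia.
by rewrite /D [(D1 + _)%N]addnC addnA !leq_add2r.
Qed.

Unset Implicit Arguments.
Set Strict Implicit.

Theorem theorem7 (R : realType) (b C : R) (hb : b != 0) :
  exists F : R,
    forall (K : lmodType laurent) (I1 I2 I1' I2' : K -> R)
      (A : set K) (F' : nat),
      pair_of_valuations C b I1 I2 ->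
      pair_of_valuations C b I1' I2' ->
      finite_set A ->
      good_generating_set b I1 I2 I1' I2' F F' A ->
      (exists2 a, A a & a != 0) ->
      has_deep_pockets (semidirect_gens A).
Proof.
(* [C] may be negative, whereas the estimates use a nonnegative constant. *)
pose C' := Num.max C 0; exists (4 * C') => K I1 I2 I1' I2' A F' pI pI' finA gA nzA.
have C'0 : 0 <= C' by rewrite le_max lexx orbT.
have CC' : C <= C' by rewrite le_max lexx.
have [b0|b0|b0] := ltgtP b 0; last by rewrite b0 eqxx in hb.
  have b0' : 0 < - b by rewrite oppr_gt0.
  exact: (deep_pockets_pos b0' C'0 (pair_swap (pairW CC' pI))
    (pair_swap (pairW CC' pI')) finA (good_generating_set_swap gA) nzA).
exact: (deep_pockets_pos b0 C'0 (pairW CC' pI) (pairW CC' pI') finA gA nzA).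
Qed.
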